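(* Suppose that property LD holds and $\inf_{E\in\mathbb{R}}L(E)>0$. Then for $P$-almost every $\omega\in\Omega$, $$\liminf_{N\to\infty}\left(-\frac1N\log\mathcal{I}(N,\omega)\right)>0.$$
   Context: Let $(\Omega,\mathcal F,P)$ be a probability space and $\phi:\Omega\to\Omega$ a measurable bijection with measurable inverse, $P$-preserving and ergodic. Let $f:\Omega\to\mathbb{R}$ be bounded measurable and $v_\omega(n)=f(\phi^n\omega)$, $n\in\mathbb{Z}$. For $E\in\mathbb{R}$, $T_{N,\omega}(E)=A_{N,\omega}(E)\cdots A_{1,\omega}(E)$ with $A_{n,\omega}(E)=\begin{pmatrix}v_\omega(n)-E&-1\\1&0\end{pmatrix}$; $\|\cdot\|$ is the operator norm. The Lyapunov exponent is $L(E)=\lim_{N\to\infty}\frac1N\int_\Omega\log\|T_{N,\omega}(E)\|\,dP(\omega)$. Define $\mathcal{I}(N,\omega)=\int_{-\infty}^{\infty}\frac{dE}{\|T_{N,\omega}(E)\|^2}$. Property LD (large deviation type estimate) means: for every $\epsilon>0$ and every finite closed interval $[a,b]$ there are constants $C,\eta>0$ such that $P\left(\left\{\omega:\left|\frac1N\log\|T_{N,\omega}(E)\|-L(E)\right|\ge\epsilon\right\}\right)\le Ce^{-\eta N}$ for all $N\in\mathbb{N}$ and all $E\in[a,b]$. *)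

(* Defs.v *)
From HB Require Import structures.
From mathcomp Require Import all_boot all_order all_algebra.
From mathcomp Require Import all_classical all_reals all_analysis.
Set Implicit Arguments. Unset Strict Implicit. Unset Printing Implicit Defensive.
Import Order.TTheory GRing.Theory Num.Theory.
Import numFieldNormedType.Exports.
Local Open Scope classical_set_scope.
Local Open Scope ring_scope.

Section Defs.
Context {d : measure_display} {T : measurableType d} {R : realType}.

Definition vnorm2 (x : 'cV[R]_2) : R := Num.sqrt (x 0 0 ^+ 2 + x 1 0 ^+ 2).

Definition opnorm (A : 'M[R]_2) : R :=
  sup [set vnorm2 (A *m x) | x in [set x : 'cV[R]_2 | vnorm2 x = 1]].

Definition Amat (x E : R) : 'M[R]_2 :=
  \matrix_(i < 2, j < 2)
    if (i == 0 :> nat) then (if (j == 0 :> nat) then x - E else -1)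
    else (if (j == 0 :> nat) then 1 else 0).

Definition vpot (phi : T -> T) (f : T -> R) (w : T) (n : nat) : R :=
  f (iter n phi w).

Fixpoint Tmat (phi : T -> T) (f : T -> R) (N : nat) (w : T) (E : R) : 'M[R]_2 :=
  match N with
  | 0%N => 1%:M
  | N'.+1 => Amat (vpot phi f w N'.+1) E *m Tmat phi f N' w E
  end.

Definition lyap (P : probability T R) (phi : T -> T) (f : T -> R) (E : R) : R :=
  limn (fun N : nat => N%:R^-1 *
          Rintegral P setT (fun w => ln (opnorm (Tmat phi f N w E)))).

Definition Iint (phi : T -> T) (f : T -> R) (N : nat) (w : T) : \bar R :=
  (\int[@lebesgue_measure R]_(E in setT) ((opnorm (Tmat phi f N w E)) ^-2)%:E)%E.

Definition measure_preserving (P : probability T R) (phi : T -> T) : Prop :=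
  forall A, measurable A -> P (phi @^-1` A) = P A.

Definition ergodic (P : probability T R) (phi : T -> T) : Prop :=
  forall A, measurable A -> phi @^-1` A = A -> P A = 0%E \/ P A = 1%E.

Definition property_LD (P : probability T R) (phi : T -> T) (f : T -> R) : Prop :=
  forall eps : R, 0 < eps -> forall a b : R,
  exists C eta : R, 0 < C /\ 0 < eta /\
    forall (N : nat) (E : R), (1 <= N)%N -> a <= E <= b ->
      (P [set w | (eps <= `| N%:R^-1 * ln (opnorm (Tmat phi f N w E)) - lyap P phi f E |)%R]
        <= (C * expR (- (eta * N%:R)))%:E)%E.

End Defs.

(* Main.v *)
Require Import Defs.
From HB Require Import structures.
From mathcomp Require Import all_boot all_order all_algebra.
From mathcomp Require Import all_classical all_reals all_analysis.
From mathcomp Require Import measurable_realfun ring lra.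
Import Order.TTheory GRing.Theory Num.Theory.
Import numFieldNormedType.Exports.
Local Open Scope classical_set_scope.
Local Open Scope ring_scope.

(** For a fixed energy E the mean over w of [opnorm (Tmat phi f N w E) ^- 2] is
    at most C e^{-cN} / (1 + E^2): for bounded E this is property LD together
    with [1 <= opnorm], and for |E| large the upper left entry of the transfer
    matrix grows at least like (|E| - M - 1)^N, where M bounds |f|.  By Tonelli
    the mean of I(N, w) is at most C' e^{-cN}, so the series of the
    e^{cN/2} I(N, w) has a finite mean.  It is thus finite almost everywhere,
    and then I(N, w) <= J(w) e^{-cN/2} for all N. *)

(** The larger eigenvalue of [A^T *m A], whose entries are p, q, q, r. *)
Definition sqsingval {R : realType} (A : 'M[R]_2) : R :=
  let p := A 0 0 ^+ 2 + A 1 0 ^+ 2 in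
  let r := A 0 1 ^+ 2 + A 1 1 ^+ 2 in
  let q := A 0 0 * A 0 1 + A 1 0 * A 1 1 in
  (p + r + Num.sqrt ((p - r) ^+ 2 + 4 * q ^+ 2)) / 2.

(** * The operator norm of a real 2x2 matrix in closed form *)

Section OpNorm.
Context {R : realType}.
Implicit Type A : 'M[R]_2.

(** The product identity is the vanishing of the characteristic polynomial of [A^T *m A]; the two
    inequalities, due to [s >= |p - r|], single out the larger root. Apart from measurability, only
    these three facts about the formula are needed later. *)
Lemma sqsingval_charpoly A :
  let p := A 0 0 ^+ 2 + A 1 0 ^+ 2 in
  let r := A 0 1 ^+ 2 + A 1 1 ^+ 2 in
  let q := A 0 0 * A 0 1 + A 1 0 * A 1 1 in
  [/\ p <= sqsingval A, r <= sqsingval A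
    & (sqsingval A - p) * (sqsingval A - r) = q ^+ 2].
Proof.
move=> p r q; rewrite /sqsingval -/p -/r -/q.
have D0 : 0 <= (p - r) ^+ 2 + 4 * q ^+ 2.
  by rewrite addr_ge0 ?sqr_ge0// mulr_ge0// sqr_ge0.
have s2 := sqr_sqrtr D0.
have : `|p - r| <= Num.sqrt ((p - r) ^+ 2 + 4 * q ^+ 2).
  by rewrite -sqrtr_sqr ler_sqrt// lerDl mulr_ge0// sqr_ge0.
set s := Num.sqrt _ in s2 *.
rewrite ler_norml => /andP[h1 h2]; split; [lra|lra|].
have -> : ((p + r + s) / 2 - p) * ((p + r + s) / 2 - r) =
  (s ^+ 2 - (p - r) ^+ 2) / 4 by field.
by rewrite s2; field.
Qed.

Lemma vnorm2_mulmx A (x : 'cV[R]_2) : vnorm2 (A *m x) =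
  Num.sqrt ((A 0 0 ^+ 2 + A 1 0 ^+ 2) * x 0 0 ^+ 2 +
   2 * (A 0 0 * A 0 1 + A 1 0 * A 1 1) * (x 0 0 * x 1 0) +
   (A 0 1 ^+ 2 + A 1 1 ^+ 2) * x 1 0 ^+ 2).
Proof.
rewrite /vnorm2 !mxE !big_ord_recl !big_ord0.
have -> : lift ord0 ord0 = 1 :> 'I_2 by apply/val_inj.
have -> : ord0 = 0 :> 'I_2 by [].
by congr (Num.sqrt _); ring.
Qed.

Lemma vnorm2_eq1 (x : 'cV[R]_2) :
  vnorm2 x = 1 <-> x 0 0 ^+ 2 + x 1 0 ^+ 2 = 1.
Proof.
rewrite /vnorm2; split=> [h|->]; last by rewrite sqrtr1.
by rewrite -[LHS]sqr_sqrtr ?addr_ge0 ?sqr_ge0// h expr1n.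
Qed.

(** On the unit circle the difference of the squares is a quadratic form with matrix [l - A^T *m A].
    Its diagonal is nonnegative and its determinant is zero, so it is positive semidefinite. *)
Lemma vnorm2_mulmx_le A x : vnorm2 x = 1 ->
  vnorm2 (A *m x) <= Num.sqrt (sqsingval A).
Proof.
move=> /vnorm2_eq1 x1; rewrite vnorm2_mulmx ler_wsqrtr//.
have [] := sqsingval_charpoly A; cbv zeta.
set p := _ + A 1 0 ^+ 2; set r := _ + A 1 1 ^+ 2; set q := _ + A 1 0 * A 1 1.
set l := sqsingval A => pl rl plrl.
have -> : l = l * (x 0 0 ^+ 2 + x 1 0 ^+ 2) by rewrite x1 mulr1.
move: (x 0 0) (x 1 0) => u v {x1}; rewrite -subr_ge0.
have -> : l * (u ^+ 2 + v ^+ 2) - (p * u ^+ 2 + 2 * q * (u * v) + r * v ^+ 2) =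
  (l - p) * u ^+ 2 - 2 * q * u * v + (l - r) * v ^+ 2 by ring.
rewrite -subr_ge0 in pl; rewrite -subr_ge0 in rl.
move: (l - p) (l - r) pl rl plrl => a b a0 b0 ab.
move: a0; rewrite le_eqVlt => /orP[/eqP a0|a0].
  move: ab; rewrite -a0 mul0r => /esym/eqP; rewrite sqrf_eq0 => /eqP ->.
  by rewrite mul0r mulr0 !mul0r subr0 add0r mulr_ge0// sqr_ge0.
(* Multiplying by [a > 0] completes the square: with [a * b = q ^+ 2] the form becomes
   [(a * u - q * v) ^+ 2]. *)
rewrite -(pmulr_rge0 _ a0).
have -> : a * (a * u ^+ 2 - 2 * q * u * v + b * v ^+ 2) =
  (a * u) ^+ 2 - 2 * a * q * u * v + (a * b) * v ^+ 2 by ring.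
rewrite ab.
have -> : (a * u) ^+ 2 - 2 * a * q * u * v + q ^+ 2 * v ^+ 2 =
  (a * u - q * v) ^+ 2 by ring.
exact: sqr_ge0.
Qed.

(** The maximum is reached at a unit eigenvector for the larger eigenvalue [l]: the normalised
    [(q, l - p)], or [(1, 0)] when [l = p], which forces [q = 0]. *)
Lemma vnorm2_mulmx_attained A :
  exists2 x, vnorm2 x = 1 & vnorm2 (A *m x) = Num.sqrt (sqsingval A).
Proof.
have [] := sqsingval_charpoly A; cbv zeta.
set p := _ + A 1 0 ^+ 2; set r := _ + A 1 1 ^+ 2; set q := _ + A 1 0 * A 1 1.
set l := sqsingval A => pl rl plrl.
suff [u [v [uv1 uvl]]] : exists u v : R, u ^+ 2 + v ^+ 2 = 1 /\
    p * u ^+ 2 + 2 * q * (u * v) + r * v ^+ 2 = l.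
  exists (\col_(i < 2) if i == 0 then u else v).
    by apply/vnorm2_eq1; rewrite !mxE.
  by rewrite vnorm2_mulmx !mxE/= uvl.
have [lp|lp] := eqVneq l p.
  exists 1, 0; move: plrl; rewrite lp subrr mul0r => /esym/eqP.
  by rewrite sqrf_eq0 => /eqP ->; split; ring.
have lp0 : 0 < l - p by rewrite subr_gt0 lt_neqAle eq_sym lp.
have n0 : 0 < q ^+ 2 + (l - p) ^+ 2.
  by rewrite ltr_wpDl ?sqr_ge0// exprn_gt0.
set n := Num.sqrt (q ^+ 2 + (l - p) ^+ 2).
have n2 : n ^+ 2 = q ^+ 2 + (l - p) ^+ 2 by rewrite sqr_sqrtr// ltW.
have nn0 : n != 0 by rewrite gt_eqF// sqrtr_gt0.
exists (q / n), ((l - p) / n); split.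
  by rewrite !expr_div_n -mulrDl n2 divff// gt_eqF.
apply/eqP; rewrite -subr_eq0.
have -> : p * (q / n) ^+ 2 + 2 * q * (q / n * ((l - p) / n)) +
    r * ((l - p) / n) ^+ 2 - l =
  (p * q ^+ 2 + 2 * q ^+ 2 * (l - p) + r * (l - p) ^+ 2 - l * n ^+ 2) / n ^+ 2.
  by field.
have -> : p * q ^+ 2 + 2 * q ^+ 2 * (l - p) + r * (l - p) ^+ 2 - l * n ^+ 2 =
  (l - p) * (q ^+ 2 - (l - p) * (l - r)) by rewrite n2; ring.
by rewrite plrl subrr mulr0 mul0r.
Qed.

Lemma opnormE A : opnorm A = Num.sqrt (sqsingval A).
Proof.
have [x x1 xA] := vnorm2_mulmx_attained A.
have ubA : ubound [set vnorm2 (A *m y) | y in [set y : 'cV[R]_2 | vnorm2 y = 1]]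
    (Num.sqrt (sqsingval A)).
  by move=> _ [y y1 <-]; exact: vnorm2_mulmx_le.
apply/eqP; rewrite eq_le; apply/andP; split.
  by apply: ge_sup => //; exists (vnorm2 (A *m x)); exists x.
by rewrite -xA; apply: ub_le_sup; [exists (Num.sqrt (sqsingval A))|exists x].
Qed.

Lemma sqsingval_ge0 A : 0 <= sqsingval A.
Proof.
by have [+ _ _] := sqsingval_charpoly A; apply: le_trans; rewrite addr_ge0 ?sqr_ge0.
Qed.

Lemma opnorm_ge0 A : 0 <= opnorm A.
Proof. by rewrite opnormE sqrtr_ge0. Qed.

Lemma sqr_opnorm A : opnorm A ^+ 2 = sqsingval A.
Proof. by rewrite opnormE sqr_sqrtr// sqsingval_ge0. Qed.

Lemma sqr_opnorm_ge00 A : A 0 0 ^+ 2 <= opnorm A ^+ 2.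
Proof.
have [+ _ _] := sqsingval_charpoly A; rewrite -sqr_opnorm.
by apply: le_trans; rewrite lerDl sqr_ge0.
Qed.

(** Twice the squared norm is at least the squared Frobenius norm [p + r], and [p + r] minus twice
    the determinant is the sum of the squares of [A 0 0 - A 1 1] and [A 0 1 + A 1 0]. *)
Lemma opnorm_ge1 A : A 0 0 * A 1 1 - A 0 1 * A 1 0 = 1 -> 1 <= opnorm A.
Proof.
move=> A1.
rewrite -(@ler_pXn2r _ 2)// ?nnegrE ?opnorm_ge0// expr1n sqr_opnorm.
have [lp lr _] := sqsingval_charpoly A.
have := sqr_ge0 (A 0 0 - A 1 1); have := sqr_ge0 (A 0 1 + A 1 0); nra.
Qed.

End OpNorm.

(** * Transfer matrices: recurrence, determinant, growth at large energy, measurability *)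

Section Transfer.
Context {d : measure_display} {T : measurableType d} {R : realType}.
Variables (phi : T -> T) (f : T -> R).

Lemma Tmat0S N w E j : Tmat phi f N.+1 w E 0 j =
  (vpot phi f w N.+1 - E) * Tmat phi f N w E 0 j - Tmat phi f N w E 1 j.
Proof.
rewrite /= mxE !big_ord_recl big_ord0 !mxE/= addr0 mulN1r.
by congr (_ - Tmat _ _ _ _ _ _ _); apply/val_inj.
Qed.

Lemma Tmat1S N w E j : Tmat phi f N.+1 w E 1 j = Tmat phi f N w E 0 j.
Proof. by rewrite /= mxE !big_ord_recl big_ord0 !mxE/= addr0 mul1r mul0r addr0. Qed.

Lemma det_Tmat N w E : let A := Tmat phi f N w E in
  A 0 0 * A 1 1 - A 0 1 * A 1 0 = 1.
Proof.
cbv zeta; elim: N => [|N IH]; first by rewrite /= !mxE/=; ring.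
by move: IH; rewrite !Tmat0S !Tmat1S => <-; ring.
Qed.

Lemma opnorm_Tmat_ge1 N w E : 1 <= opnorm (Tmat phi f N w E).
Proof. exact/opnorm_ge1/det_Tmat. Qed.

Lemma opnorm_Tmat_gt0 N w E : 0 < opnorm (Tmat phi f N w E).
Proof. exact: lt_le_trans (opnorm_Tmat_ge1 _ _ _). Qed.

(** The first column obeys the recurrence t' = (v - E) t - u with [|v - E| >= K + 1]. As long as
    [|u| <= |t|], this gives [|t'| >= K |t| >= |t|], so the domination of u by t passes to the next
    step. *)
Lemma normr_Tmat00_ge N w E (M K : R) : (forall x, `|f x| <= M) -> 1 <= K ->
  M + K + 1 <= `|E| -> K ^+ N <= `|Tmat phi f N w E 0 0|.
Proof.
move=> fM K1 EK.
have step n : `|Tmat phi f n w E 1 0| <= `|Tmat phi f n w E 0 0| ->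
    K * `|Tmat phi f n w E 0 0| <= `|Tmat phi f n.+1 w E 0 0|.
  move=> h; rewrite Tmat0S.
  set t := Tmat phi f n w E 0 0; set u := Tmat phi f n w E 1 0.
  have vE : K + 1 <= `|vpot phi f w n.+1 - E|.
    have := lerB_dist E (vpot phi f w n.+1); rewrite distrC.
    by have := fM (iter n.+1 phi w); rewrite -/(vpot _ _ _ _); lra.
  have := lerB_dist ((vpot phi f w n.+1 - E) * t) u; rewrite normrM.
  have := ler_wpM2r (normr_ge0 t) vE; rewrite -/t -/u in h; lra.
have le10 n : `|Tmat phi f n w E 1 0| <= `|Tmat phi f n w E 0 0|.
  elim: n => [|n IH]; first by rewrite /= !mxE/= normr0.
  rewrite Tmat1S (le_trans _ (step _ IH))// ler_peMl//.
elim: N => [|N IH]; first by rewrite /= mxE/= normr1 expr0.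
by rewrite (le_trans _ (step _ (le10 N)))// exprS ler_wpM2l// (le_trans _ K1).
Qed.

Lemma measurable_Tmat N (mphi : measurable_fun setT phi)
    (mf : measurable_fun setT f) (i j : 'I_2) :
  measurable_fun setT (fun z : T * measurableTypeR R => Tmat phi f N z.1 z.2 i j).
Proof.
have miter n : measurable_fun setT (iter n phi).
  by elim: n => [|n IH] /=; [exact: measurable_id|exact: measurableT_comp].
(* Coding the row by a boolean lets a single induction treat both rows, each of which refers to the
   other. *)
have -> : i = if i == 0 then 0 else 1.
  by apply/val_inj; case: i => -[|[]].
elim: N (i == 0) => [|N IH] b; first exact: measurable_cst.
case: b; last by under eq_fun do rewrite Tmat1S; exact: (IH true).
under eq_fun do rewrite Tmat0S.
apply: measurable_funB; last exact: (IH false).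
apply: measurable_funM; last exact: (IH true).
apply: measurable_funB; last exact: measurable_snd.
exact: (measurableT_comp mf (measurableT_comp (miter N.+1) measurable_fst)).
Qed.

Lemma measurable_opnorm_Tmat N (mphi : measurable_fun setT phi)
    (mf : measurable_fun setT f) :
  measurable_fun setT
    (fun z : T * measurableTypeR R => opnorm (Tmat phi f N z.1 z.2)).
Proof.
have m i j := @measurable_Tmat N mphi mf i j.
under eq_fun do rewrite opnormE.
apply: measurableT_comp.
  exact: continuous_measurable_fun (@sqrt_continuous R).
have m2 i j := measurable_funX 2 (m i j).
have mp i := measurable_funD (m2 0 i) (m2 1 i).
apply: measurable_funM; last exact: measurable_cst.
apply: measurable_funD; first exact: measurable_funD (mp 0) (mp 1).
apply: measurableT_comp.
  exact: continuous_measurable_fun (@sqrt_continuous R).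
apply: measurable_funD.
  exact: measurable_funX (measurable_funB (mp 0) (mp 1)).
apply: measurable_funM; first exact: measurable_cst.
by apply: measurable_funX; apply: measurable_funD; apply: measurable_funM.
Qed.

End Transfer.

(** * Two real-analysis tools: the integral of the envelope 1 / (1 + x^2), and a liminf criterion *)

Lemma oneDsqr_gt0 (R : realType) (x : R) : 0 < oneDsqr x.
Proof. exact: lt_le_trans (oneDsqr_ge1 x). Qed.

Lemma integralT_oneDsqr (R : realType) :
  (\int[@lebesgue_measure R]_x (oneDsqr x)^-1%:E = pi%:E)%E.
Proof.
rewrite ge0_symfun_integralT//=.
- have -> : [set x : R | 0 <= x] = `[0, +oo[%classic.
    by apply/seteqP; split => x /=; rewrite in_itv/= andbT.
  by rewrite integral0y_oneDsqr -EFinM; congr EFin; lra.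
- exact: continuous_oneDsqrV.
- by move=> x; rewrite /= /oneDsqr sqrrN.
Qed.

(** The n-th term is at least c - ln J / n, hence eventually at least c / 2. Strict positivity of
    [u n] matters because [ln 0] is 0 by convention; finiteness, needed for [fine], follows from the
    upper bound. *)
Lemma limn_einf_gt0 (R : realType) (u : nat -> \bar R) (c J : R) : 0 < c ->
  (forall n, (0 < n)%N -> (0 < u n <= (J * expR (- (c * n%:R)))%:E)%E) ->
  (0 < limn_einf (fun n => (- (n%:R^-1 * ln (fine (u n))))%:E))%E.
Proof.
move=> c0 uJ; apply: (@lt_le_trans _ _ (c / 2)%:E).
  by rewrite lte_fin divr_gt0.
have J0 : 0 < J.
  have /andP[u1 /(lt_le_trans u1)] := uJ 1%N isT.
  by rewrite lte_fin pmulr_lgt0// expR_gt0.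
rewrite limn_einf_lim; apply: lime_ge; first exact: is_cvg_einfs.
near=> m; apply: le_ereal_inf_tmp => _ [n /= mn <-].
have n0 : (0 < n)%N by apply: leq_trans mn; near: m; exists 1%N.
have {uJ} := uJ n n0.
case: (u n) => [r| |] /andP[]; rewrite ?ltxx ?leye_eq ?lt_neqAle//= => r0 rJ.
rewrite !lee_fin/= in r0 rJ *; rewrite eqe in r0; case/andP: r0 => r0 r0'.
have {r0 r0'} r0 : 0 < r by rewrite lt_neqAle r0.
have lnr : ln r <= ln J - c * n%:R.
  by rewrite -ler_expR expRD !lnK ?posrE.
have n0' : 0 < n%:R :> R by rewrite ltr0n.
rewrite -mulrN ler_pdivlMl//.
(* From this rank on, half of the rate absorbs the constant: ln J <= (c / 2) n. *)
have : ln J / (c / 2) <= n%:R.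
  rewrite (@le_trans _ _ m%:R)// ?ler_nat//.
  by near: m; exact: nbhs_infty_ger.
by rewrite ler_pdivrMr ?divr_gt0//; lra.
Unshelve. all: by end_near. Qed.

(** * Exponential decay of the mean of I(N, w) *)

Section LargeDeviation.
Context {d : measure_display} {T : measurableType d} {R : realType}.
Variables (P : probability T R) (phi : T -> T) (f : T -> R).
Hypothesis mphi : measurable_fun setT phi.
Hypothesis mf : measurable_fun setT f.

Local Notation h N w E := (opnorm (Tmat phi f N w E) ^- 2).

Lemma inv_sqr_opnorm_Tmat_gt0 N w E : 0 < h N w E.
Proof. by rewrite invr_gt0 exprn_gt0// opnorm_Tmat_gt0. Qed.

Lemma measurable_inv_sqr_opnorm_Tmat N : measurable_fun setT
  (fun z : T * measurableTypeR R => (h N z.1 z.2)%:E).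
Proof.
apply/measurable_EFinP.
(* Since the norm is positive, its inverse square is the exponential of minus twice its logarithm, a
   composition of measurable maps. *)
have -> : (fun z : T * measurableTypeR R => h N z.1 z.2) =
    fun z => expR (- (ln (opnorm (Tmat phi f N z.1 z.2)) *+ 2)).
  apply/funext => z; rewrite expRN -lnXn ?opnorm_Tmat_gt0// lnK//.
  by rewrite posrE exprn_gt0// opnorm_Tmat_gt0.
apply: measurableT_comp; first exact: measurable_expR.
apply: measurable_funN; under eq_fun do rewrite mulr2n.
have mln : measurable_fun setT
    (fun z : T * measurableTypeR R => ln (opnorm (Tmat phi f N z.1 z.2))).
  by apply: measurableT_comp; [exact: measurable_ln|exact: measurable_opnorm_Tmat].
exact: measurable_funD.
Qed.

Lemma measurable_inv_sqr_opnorm_Tmat1 N E :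
  measurable_fun setT (fun w => (h N w E)%:E).
Proof.
exact: (measurableT_comp (measurable_inv_sqr_opnorm_Tmat N)
  (pair2_measurable (E : measurableTypeR R))).
Qed.

Lemma measurable_inv_sqr_opnorm_Tmat2 N w :
  measurable_fun setT (fun E : measurableTypeR R => (h N w E)%:E).
Proof.
exact: (measurableT_comp (measurable_inv_sqr_opnorm_Tmat N)
  (pair1_measurable w)).
Qed.

Lemma measurable_Iint N : measurable_fun setT (Iint phi f N).
Proof.
have := @measurable_fun_fubini_tonelli_F _ _ _ _ _ (@lebesgue_measure R) _
  (measurable_inv_sqr_opnorm_Tmat N).
by apply => -[w E] /=; rewrite lee_fin ltW// inv_sqr_opnorm_Tmat_gt0.
Qed.

(** A zero integral would make the integrand vanish almost everywhere; as it is positive everywhere,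
    the exceptional null set would contain the unit interval. This keeps the final logarithm away
    from [ln 0]. *)
Lemma Iint_gt0 N w : (0 < Iint phi f N w)%E.
Proof.
have h0 E : (0 <= (h N w E)%:E)%E by rewrite lee_fin ltW// inv_sqr_opnorm_Tmat_gt0.
rewrite lt_neqAle; apply/andP; split; last first.
  by apply: integral_ge0 => E _; exact: h0.
apply/eqP => /esym I0.
have : \forall E \ae @lebesgue_measure R, setT E -> (h N w E)%:E = 0%E.
  apply/ae_eq_integral_abs => //; first exact: measurable_inv_sqr_opnorm_Tmat2.
  by under eq_integral do rewrite gee0_abs//.
move=> [A [mA A0 hA]].
have : (@lebesgue_measure R `[0%R, 1%R]%classic <= @lebesgue_measure R A)%E.
  apply: le_measure; rewrite ?inE// => E _; apply: hA => /= /(_ I) [] /eqP.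
  by rewrite gt_eqF// inv_sqr_opnorm_Tmat_gt0.
by rewrite A0 lebesgue_measure_itv/= lte01 oppr0 adde0 lee_fin ler10.
Qed.

Lemma integral_Iint N : (\int[P]_w Iint phi f N w =
  \int[@lebesgue_measure R]_E \int[P]_w (h N w E)%:E)%E.
Proof.
have := @fubini_tonelli _ _ _ _ _ P (@lebesgue_measure R) _
  (measurable_inv_sqr_opnorm_Tmat N).
by apply => -[w E] /=; rewrite lee_fin ltW// inv_sqr_opnorm_Tmat_gt0.
Qed.

(** On the deviation set the integrand is at most 1. Off it, (1/N) ln of the norm exceeds
    [lyap - g / 2 >= g / 2], so the inverse square is at most e^{-gN}. *)
Lemma integral_inv_sqr_opnorm_deviation (N : nat) (E g q : R) :
  (0 < N)%N -> g <= lyap P phi f E ->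
  (P [set w | (g / 2 <= `| N%:R^-1 * ln (opnorm (Tmat phi f N w E)) -
      lyap P phi f E |)%R] <= q%:E)%E ->
  (\int[P]_w (h N w E)%:E <= (q + expR (- (g * N%:R)))%:E)%E.
Proof.
move=> N0 gL; set A := [set w | _] => PA.
have mA : measurable A.
  rewrite /A -[X in measurable X]setTI.
  have mo : measurable_fun setT (fun w => opnorm (Tmat phi f N w E)).
    exact: (measurableT_comp (measurable_opnorm_Tmat _ _ N mphi mf)
      (pair2_measurable (E : measurableTypeR R))).
  have : measurable_fun setT (fun w => g / 2 <=
      `| N%:R^-1 * ln (opnorm (Tmat phi f N w E)) - lyap P phi f E |).
    apply: measurable_fun_ler; first exact: measurable_cst.
    apply: measurableT_comp; first exact: normr_measurable.
    apply: measurable_funB; last exact: measurable_cst.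
    apply: measurable_funM; first exact: measurable_cst.
    by apply: measurableT_comp; [exact: measurable_ln|].
  by move=> /(_ measurableT [set true] I).
apply: (@le_trans _ _ (\int[P]_w ((\1_A w)%:E + (expR (- (g * N%:R)))%:E))%E).
  apply: ge0_le_integral => //.
  - by move=> w _; rewrite lee_fin ltW// inv_sqr_opnorm_Tmat_gt0.
  - exact: measurable_inv_sqr_opnorm_Tmat1.
  - apply: emeasurable_funD; last exact: measurable_cst.
    exact/measurable_EFinP/measurable_indic.
  move=> w _; rewrite -EFinD lee_fin indicE.
  have [wA|] := boolP (w \in A).
    rewrite (@le_trans _ _ 1)// ?lerDl ?expR_ge0//.
    by rewrite invf_le1 ?exprn_gt0 ?opnorm_Tmat_gt0// exprn_ege1// opnorm_Tmat_ge1.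
  rewrite notin_setE /A /= => /negP; rewrite -ltNge add0r => wA.
  have N0' : 0 < N%:R :> R by rewrite ltr0n.
  rewrite expRN lef_pV2 ?posrE ?expR_gt0 ?exprn_gt0 ?opnorm_Tmat_gt0//.
  rewrite -[leRHS]lnK ?posrE ?exprn_gt0 ?opnorm_Tmat_gt0// ler_expR.
  rewrite lnXn ?opnorm_Tmat_gt0//.
  have : g / 2 <= N%:R^-1 * ln (opnorm (Tmat phi f N w E)).
    by move: wA; rewrite ltr_norml => /andP[]; lra.
  by rewrite ler_pdivlMl// -mulr_natr; lra.
rewrite ge0_integralD//; last exact/measurable_EFinP/measurable_indic.
rewrite integral_indic// setIT integral_cst//.
rewrite [X in (_ * X)%E](_ : _ = 1%E); last exact: probability_setT.
by rewrite mule1 EFinD; exact: leeD.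
Qed.

Lemma integral_inv_sqr_opnorm_large_energy (N : nat) (E M : R) :
  (0 < N)%N -> (forall w, `|f w| <= M) ->
  0 <= M -> 2 * M + 6 <= `|E| ->
  (\int[P]_w (h N w E)%:E <= (8 * 2 ^- N * (oneDsqr E)^-1)%:E)%E.
Proof.
move=> N0 fM M0 EM.
rewrite -[leRHS]mule1 -(probability_setT P) -integral_cst//.
apply: ge0_le_integral => //.
- by move=> w _; rewrite lee_fin ltW// inv_sqr_opnorm_Tmat_gt0.
- exact: measurable_inv_sqr_opnorm_Tmat1.
move=> w _; rewrite lee_fin.
have -> : 8 * 2 ^- N * (oneDsqr E)^-1 = (2 ^+ N * oneDsqr E / 8)^-1.
  by rewrite !invfM invrK; ring.
have oE : 0 < oneDsqr E by exact: oneDsqr_gt0.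
rewrite lef_pV2 ?posrE ?divr_gt0 ?mulr_gt0 ?exprn_gt0 ?opnorm_Tmat_gt0//.
apply: le_trans (sqr_opnorm_ge00 _).
(* The threshold [2 * M + 6] is exactly what makes [M + K + 1 <= |E|] for this [K]. *)
set K := `|E| / 2 + 2.
have K2 : 2 <= K by rewrite /K; have := normr_ge0 E; lra.
have := @normr_Tmat00_ge _ _ _ phi f N w E M K fM.
have -> : 1 <= K by lra.
have -> : M + K + 1 <= `|E| by rewrite /K; lra.
move=> /(_ isT isT) KT.
rewrite -real_normK ?num_real//.
apply: (@le_trans _ _ ((K ^+ N) ^+ 2)); last first.
  by rewrite ler_pXn2r// nnegrE ?exprn_ge0//; lra.
have oK : oneDsqr E <= 4 * K ^+ 2.
  by rewrite /oneDsqr /K -real_normK ?num_real//; have := normr_ge0 E; nra.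
(* One of the [N] factors [K ^+ 2] supplies the decay in [E] through [oneDsqr E <= 4 * K ^+ 2]; the
   other [N - 1] are each at least 2. The constant 8 is 4 times the missing factor 2. *)
case: N N0 {KT} => // n _.
rewrite -exprM mulnC exprM exprS [in leRHS]exprS.
have : 2 ^+ n <= (K ^+ 2) ^+ n by rewrite lerXn2r ?nnegrE ?sqr_ge0//; nra.
have : 0 < 2 ^+ n :> R by rewrite exprn_gt0.
move: (2 ^+ n) ((K ^+ 2) ^+ n) => a b a0 ab.
by have := sqr_ge0 K; nra.
Qed.

Lemma integral_Iint_le :
  (exists M : R, forall w, `|f w| <= M) -> property_LD P phi f ->
  0 < inf (range (lyap P phi f)) ->
  exists C c : R, [/\ 0 < C, 0 < c & forall N, (0 < N)%N ->
   (\int[P]_w Iint phi f N w <= (C * expR (- (c * N%:R)))%:E)%E].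
Proof.
move=> [M0 fM0] LD; set g := inf _ => g0.
pose M : R := `|M0|.
have fM w : `|f w| <= M by rewrite (le_trans (fM0 w))// ler_norm.
have gL E : g <= lyap P phi f E.
  apply: ge_inf; last by exists E.
  (* [inf] is 0 by default on a set without a lower bound, so [0 < g] forces the range to be bounded
     below. *)
  apply: contrapT => nlb; move: g0; rewrite /g inf_out ?ltxx// => -[_ /nlb].
  by [].
pose B : R := 2 * M + 6.
have [C1 [eta [C10 [eta0 LD1]]]] := LD (g / 2) (divr_gt0 g0 (ltr0Sn R 1)) (- B) B.
(* The three rates come from the non-deviating points, from property LD, and from the factor
   [2 ^- N] at large energies. *)
pose c := Num.min g (Num.min eta (ln 2)).
have l2 : 0 < ln 2 :> R by rewrite ln_gt0// ltr1n.
have c0 : 0 < c by rewrite !lt_min g0 eta0.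
(* The summand 8 serves [|E| >= B]. For [|E| < B] the bound is uniform in [E], and the factor
   [oneDsqr B] pays for dividing by [oneDsqr E <= oneDsqr B]. *)
pose C := 8 + (C1 + 1) * oneDsqr B.
have C0 : 0 < C.
  by rewrite ltr_wpDr// mulr_ge0 ?(ltW (oneDsqr_gt0 _))// addr_ge0// ltW.
exists (C * pi), c; split => //; first by rewrite mulr_gt0// pi_gt0.
move=> N N0; rewrite integral_Iint.
have cE x : c <= x -> expR (- (x * N%:R)) <= expR (- (c * N%:R)).
  by move=> cx; rewrite ler_expR lerN2 ler_wpM2r.
have key E : (\int[P]_w (h N w E)%:E <=
    (C * expR (- (c * N%:R)))%:E * (oneDsqr E)^-1%:E)%E.
  have oE : 0 < oneDsqr E by exact: oneDsqr_gt0.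
  have oB : 0 < oneDsqr B by exact: oneDsqr_gt0.
  have [EB|EB] := leP B `|E|.
    apply: le_trans.
      exact: (@integral_inv_sqr_opnorm_large_energy N E M N0 fM (normr_ge0 M0)).
    have oE' : 0 <= (oneDsqr E)^-1 by rewrite invr_ge0 ltW.
    rewrite -EFinM lee_fin (ler_wpM2r oE')//.
    rewrite ler_pM ?invr_ge0 ?exprn_ge0//.
      by rewrite /C lerDl (mulr_ge0 _ (ltW oB))// (addr_ge0 (ltW C10)).
    have <- : expR (- (ln 2 * N%:R)) = 2 ^- N :> R.
      by rewrite expRN mulrC expRM_natl lnK// posrE.
    by apply: cE; rewrite /c !ge_min lexx !orbT.
  have EB' : - B <= E <= B by rewrite -ler_norml ltW.
  apply: le_trans.
    exact: integral_inv_sqr_opnorm_deviation N0 (gL E) (LD1 N E N0 EB').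
  rewrite -EFinM lee_fin ler_pdivlMr//.
  have h1 : expR (- (eta * N%:R)) <= expR (- (c * N%:R)).
    by apply: cE; rewrite /c !ge_min lexx !orbT.
  have h2 : expR (- (g * N%:R)) <= expR (- (c * N%:R)).
    by apply: cE; rewrite /c ge_min lexx.
  have EoB : oneDsqr E <= oneDsqr B.
    have B0 : 0 <= B := le_trans (normr_ge0 E) (ltW EB).
    rewrite /oneDsqr lerD2l -(real_normK (num_real E)).
    by apply: lerXn2r; rewrite ?nnegrE// ltW.
  apply: (@le_trans _ _ (((C1 + 1) * expR (- (c * N%:R))) * oneDsqr B)).
    apply: ler_pM => //; first by rewrite addr_ge0 ?mulr_ge0 ?expR_ge0// ltW.
    by rewrite mulrDl mul1r lerD// (ler_wpM2l (ltW C10)).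
  by rewrite mulrAC ler_wpM2r ?expR_ge0// lerDr.
have mo : measurable_fun setT (fun E : R => (oneDsqr E)^-1%:E).
  apply/measurable_EFinP.
  exact: (continuous_measurable_fun (@continuous_oneDsqrV R)).
apply: (@le_trans _ _ (\int[@lebesgue_measure R]_E
   ((C * expR (- (c * N%:R)))%:E * (oneDsqr E)^-1%:E))%E).
  apply: ge0_le_integral => //.
  - move=> E _; apply: integral_ge0 => w _.
    by rewrite lee_fin ltW// inv_sqr_opnorm_Tmat_gt0.
  - apply: (@measurable_fun_fubini_tonelli_G _ _ _ _ _ P _
      (measurable_inv_sqr_opnorm_Tmat N)).
    by move=> [w E] /=; rewrite lee_fin ltW// inv_sqr_opnorm_Tmat_gt0.
  - apply: emeasurable_funM; first exact: measurable_cst.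
    exact: mo.
have o0 (E : R) : setT E -> (0 <= (oneDsqr E)^-1%:E)%E.
  by rewrite lee_fin invr_ge0 ltW// oneDsqr_gt0.
have k0 : (0 <= (C * expR (- (c * N%:R)))%:E)%E.
  by rewrite lee_fin mulr_ge0 ?expR_ge0// ltW.
have := ge0_integralZl (@lebesgue_measure R) measurableT mo o0 k0.
by move=> ->; rewrite integralT_oneDsqr -EFinM mulrAC.
Qed.

End LargeDeviation.

(** * From decaying means to an almost everywhere bound, and the conclusion *)

Lemma ae_geometric_bound {d : measure_display} {T : measurableType d}
    {R : realType} (mu : {measure set T -> \bar R}) (u : nat -> T -> \bar R)
    (C c : R) :
  0 < c -> (forall n, measurable_fun setT (u n)) -> (forall n x, 0 <= u n x)%E ->
  (forall n, (0 < n)%N ->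
    (\int[mu]_x u n x <= (C * expR (- (c * n%:R)))%:E)%E) ->
  {ae mu, forall x, exists J : R, forall n, (0 < n)%N ->
    (u n x <= (J * expR (- (c / 2 * n%:R)))%:E)%E}.
Proof.
move=> c0 mmu u0 uC.
(* Half of the rate goes into the weight; the other half keeps the weighted means summable. The
   index shift in [v] skips n = 0, where no bound is assumed. *)
pose e n := expR (c / 2 * n%:R).
pose v n x := ((e n.+1)%:E * u n.+1 x)%E.
have v0 n x : (0 <= v n x)%E by rewrite mule_ge0// lee_fin expR_ge0.
have mv n : measurable_fun setT (v n).
  by apply: emeasurable_funM => //; exact: measurable_cst.
have Cge0 : 0 <= C.
  have := le_trans (integral_ge0 _ (fun x _ => u0 1%N x)) (uC 1%N isT).
  by rewrite lee_fin pmulr_lge0// expR_gt0.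
(* The exact exponent is [n.+1]; one factor below 1 is dropped to obtain a standard geometric
   series. *)
have vC n : (\int[mu]_x v n x <= (C * expR (- (c / 2)) ^+ n)%:E)%E.
  rewrite ge0_integralZl ?lee_fin ?expR_ge0//.
  apply: le_trans (lee_wpmul2l _ (uC n.+1 isT)) _.
    by rewrite lee_fin expR_ge0.
  rewrite -EFinM lee_fin mulrCA ler_wpM2l// /e -expRD -expRM_natl ler_expR.
  by rewrite -(natr1 n); have : 0 <= n%:R :> R by []; nra.
have vint : mu.-integrable setT (fun x => \sum_(n <oo) v n x)%E.
  apply/integrableP; split.
    by apply: ge0_emeasurable_sum => // n x _ _.
  under eq_integral do rewrite gee0_abs ?nneseries_ge0//.
  rewrite integral_nneseries//.
  apply: (@le_lt_trans _ _ (\sum_(n <oo) (C * expR (- (c / 2)) ^+ n)%:E)%E).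
    by apply: lee_nneseries => n _; [move=> _; exact: integral_ge0|exact: vC].
  have q1 : `|expR (- (c / 2))| < 1.
    by rewrite ger0_norm ?expR_ge0// expR_lt1 oppr_lt0 divr_gt0.
  rewrite (_ : limn _ = (C / (1 - expR (- (c / 2))))%:E) ?ltry//.
  apply/cvg_lim => //; apply: cvg_EFin.
    by apply: nearW => n; rewrite sumEFin.
  rewrite [X in X @ _ --> _](_ : _ = series (geometric C (expR (- (c / 2))))).
    exact: cvg_geometric_series.
  by apply/funext => n; rewrite /= sumEFin.
apply: filterS (integrable_ae measurableT vint) => x /(_ I) vx.
(* The sum of the weighted series is the constant: each term is at most a partial sum, hence at most
   the whole sum, as all terms are nonnegative. *)
exists (fine (\sum_(n <oo) v n x)%E) => -[//|n] _.
rewrite EFinM fineK// expRN lee_pdivlMr ?expR_gt0// muleC.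
apply: le_trans (@nneseries_lim_ge R (v^~ x) xpredT 0%N n.+1 _) => //.
by rewrite big_nat_recr//= leeDr// sume_ge0.
Qed.

Theorem theorem3p9 (d : measure_display) (T : measurableType d) (R : realType)
  (P : probability T R) (phi : T -> T) (f : T -> R) :
  measurable_fun setT phi ->
  (exists2 phi_inv : T -> T, cancel phi phi_inv /\ cancel phi_inv phi &
     measurable_fun setT phi_inv) ->
  measure_preserving P phi ->
  ergodic P phi ->
  measurable_fun setT f ->
  (exists M : R, forall w, `|f w| <= M) ->
  property_LD P phi f ->
  0 < inf (range (lyap P phi f)) ->
  {ae P, forall w : T,
     (0 < limn_einf (fun N : nat =>
            (- (N%:R^-1 * ln (fine (Iint phi f N w))))%:E))%E}.
Proof.
move=> mphi _ _ _ mf fM LD inf_gt0.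
have [C [c [_ c0 IC]]] := integral_Iint_le _ _ _ mphi mf fM LD inf_gt0.
apply: filterS (ae_geometric_bound P (Iint phi f) C c c0 _ _ IC).
- move=> w [J IJ]; apply: (@limn_einf_gt0 _ (Iint phi f ^~ w) (c / 2) J).
    exact: divr_gt0.
  by move=> N N0; rewrite Iint_gt0//= IJ.
- exact: measurable_Iint.
- by move=> N w; rewrite ltW// Iint_gt0.
Qed.
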